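(* Let $D$ be a right invariant split type distance on $S_\infty$ and let $R>0$. Suppose there exists an integer $N(R)$ such that $m(\sigma)-q(\sigma)\le N(R)$ for every split type $\sigma$ with $D(\sigma)=R$. Let $\beta_D(R,m,q)$ be the number of split types $\sigma\in S_m$ with $m(\sigma)=m$, $D(\sigma)=R$ and $q(\sigma)=q$. Then for all $n\ge1$ $$A_{D,n}(R)=\sum_{q=1}^{N(R)}\sum_{m=2q}^{q+N(R)}\beta_D(R,m,q)\left[\begin{matrix} n+q-m\\ q\end{matrix}\right],$$ where $\left[\begin{smallmatrix} i\\ j\end{smallmatrix}\right]=\binom{i}{j}$ if $0\le j\le i$ and $0$ otherwise; and for $n\ge N(R)$, $$A_{D,n}(R)=\sum_{q=1}^{N(R)}\sum_{m=2q}^{q+N(R)}\beta_D(R,m,q)\binom{n+q-m}{q},$$ which is a polynomial in $n$ of degree at most $N(R)$.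
   Context: For $n\ge1$, $S_n$ is the group of permutations of $[n]=\{1,\dots,n\}$, in one-line notation. $S_\infty$ is the group of permutations of $\{1,2,\dots\}$ fixing all but finitely many entries; $S_n$ is identified with the subgroup of $S_\infty$ fixing every entry $>n$. For $\pi\in S_a$, $\tau\in S_b$, the concatenation is $\pi+\tau=(\pi(1)\ldots\pi(a)\,(a+\tau(1))\ldots(a+\tau(b)))\in S_{a+b}$. A permutation is connected if it is not a concatenation $\pi+\tau$ with $\pi\in S_a,\tau\in S_b$, $a,b\ge1$; each permutation in $S_n$ is uniquely a concatenation of connected permutations (split decomposition). The split type of a permutation is the concatenation, in order, of the parts of its split decomposition different from the trivial permutation $(1)\in S_1$. A split type is a permutation $\sigma\in S_m$ all of whose split-decomposition parts are nontrivial; $m(\sigma)$ is the unique $m$ such that $\sigma\in S_m$ is a split type, and $q(\sigma)$ is the number of parts of its split decomposition. A metric $D$ on $S_\infty$ is right invariant if $D(uw,vw)=D(u,v)$ for all $u,v,w$; write $D(u)=D(\mathrm{id},u)$. $D$ is a split type distance if $D(u)=D(v)$ whenever $u,v$ have the same split type. $A_{D,n}(R)=\#\{u\in S_n: D(u)=R\}$. *)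

(* Defs.v *)
From HB Require Import structures.
From mathcomp Require Import all_boot all_order all_algebra all_fingroup.
From mathcomp Require Import boolp reals.
Set Implicit Arguments.
Unset Strict Implicit.
Unset Printing Implicit Defensive.
Import Order.TTheory GRing.Theory Num.Theory.
Local Open Scope ring_scope.

(* Entries are 0-based throughout: [n] = {1, ..., n} is 'I_n = {0, ..., n-1}
   and {1, 2, ...} is nat, the entry k standing for k + 1.                   *)

Definition finitely_moving (f : nat -> nat) : Prop :=
  exists n : nat, forall k : nat, (n <= k)%N -> f k = k.

Record Sinf : Type := MkSinf {
  sinf_fun :> nat -> nat;
  sinf_bij : bijective sinf_fun;
  sinf_fin : finitely_moving sinf_fun }.

Lemma sinfP (u v : Sinf) : (forall k : nat, u k = v k) -> u = v.
Proof.
case: u v => [f bf ff] [g bg fg] /= /funext fgE; move: bf ff; rewrite fgE.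
by move=> bf ff; rewrite (Prop_irrelevance bf bg) (Prop_irrelevance ff fg).
Qed.

Lemma sinf_id_fin : finitely_moving id.
Proof. by exists 0%N. Qed.

Definition sinf_one : Sinf :=
  MkSinf (Bijective (fun=> erefl) (fun=> erefl)) sinf_id_fin.

Lemma sinf_mul_fin (u v : Sinf) : finitely_moving (u \o v).
Proof.
have [[a ua] [b vb]] := (sinf_fin u, sinf_fin v).
by exists (maxn a b) => k; rewrite geq_max => /andP[ak bk] /=; rewrite vb ?ua.
Qed.

(* The usual product (u * v)(k) = u (v k) of permutations, which is the
   opposite of the product that MathComp puts on {perm T}.                   *)
Definition sinf_mul (u v : Sinf) : Sinf :=
  MkSinf (bij_comp (sinf_bij u) (sinf_bij v)) (sinf_mul_fin u v).

Lemma sinf_inv_exists (u : Sinf) : exists v : Sinf, cancel u v /\ cancel v u.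
Proof.
have [g ug gu] := sinf_bij u; have [n un] := sinf_fin u.
have gfin : finitely_moving g.
  by exists n => k nk; rewrite -[in LHS](un k nk) ug.
by exists (MkSinf (Bijective gu ug) gfin).
Qed.

Definition sinf_inv (u : Sinf) : Sinf := sval (cid (sinf_inv_exists u)).

Lemma sinf_mulA : associative sinf_mul.
Proof. by move=> u v w; apply: sinfP. Qed.

Lemma sinf_mul1 : left_id sinf_one sinf_mul.
Proof. by move=> u; apply: sinfP. Qed.

Lemma sinf_mulr1 : right_id sinf_one sinf_mul.
Proof. by move=> u; apply: sinfP. Qed.

Lemma sinf_mulV : left_inverse sinf_one sinf_inv sinf_mul.
Proof.
by move=> u; apply: sinfP => k /=; rewrite /sinf_inv; case: cid => v [/= ->].
Qed.

Lemma sinf_mulrV : right_inverse sinf_one sinf_inv sinf_mul.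
Proof.
by move=> u; apply: sinfP => k /=; rewrite /sinf_inv; case: cid => v [/= _ ->].
Qed.

HB.instance Definition _ := gen_eqMixin Sinf.
HB.instance Definition _ := gen_choiceMixin Sinf.
HB.instance Definition _ := isGroup.Build Sinf
  sinf_mulA sinf_mul1 sinf_mulr1 sinf_mulV sinf_mulrV.

Definition embed_fun (n : nat) (s : 'S_n) (k : nat) : nat :=
  if insub k is Some i then s i : nat else k.

Lemma embed_funK (n : nat) (s t : 'S_n) :
  cancel s t -> cancel (embed_fun s) (embed_fun t).
Proof.
move=> st k; rewrite /embed_fun.
by case: (insubP 'I_n k) => [i _ <-|nk]; rewrite ?valK ?st ?insubN.
Qed.

Lemma embed_fun_bij (n : nat) (s : 'S_n) : bijective (embed_fun s).
Proof.
by exists (embed_fun s^-1%g); apply: embed_funK; [apply: permK|apply: permKV].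
Qed.

Lemma embed_fun_fin (n : nat) (s : 'S_n) : finitely_moving (embed_fun s).
Proof. by exists n => k nk; rewrite /embed_fun insubN // -leqNgt. Qed.

Definition embed (n : nat) (s : 'S_n) : Sinf :=
  MkSinf (embed_fun_bij s) (embed_fun_fin s).

Definition concat_fun (a b : nat) (s : 'S_a) (t : 'S_b) (i : 'I_(a + b)) :
    'I_(a + b) :=
  match split i with
  | inl j => lshift b (s j)
  | inr k => rshift a (t k)
  end.

Lemma concat_fun_inj (a b : nat) (s : 'S_a) (t : 'S_b) :
  injective (concat_fun s t).
Proof.
apply: (can_inj (g := concat_fun s^-1%g t^-1%g)) => i; rewrite -[RHS]splitK.
rewrite /concat_fun; case: (split i) => j /=.
  by rewrite -[lshift b _]/(unsplit (inl _)) unsplitK permK.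
by rewrite -[rshift a _]/(unsplit (inr _)) unsplitK permK.
Qed.

Definition concat (a b : nat) (s : 'S_a) (t : 'S_b) : 'S_(a + b) :=
  perm (@concat_fun_inj a b s t).

(* Permutations of all the [n] together. The empty permutation, n = 0, is
   included only as the concatenation of an empty list of parts.             *)
Definition fperm : eqType := {n : nat & 'S_n}.

Definition fp (n : nat) (s : 'S_n) : fperm := Tagged (fun n => 'S_n) s.

Definition fconcat (u v : fperm) : fperm := fp (concat (tagged u) (tagged v)).

Definition concat_seq (l : seq fperm) : fperm :=
  foldr fconcat (fp (1%g : 'S_0)) l.

Definition trivial_part : fperm := fp (1%g : 'S_1).

Definition connected (u : fperm) : Prop :=
  (0 < tag u)%N /\
  forall (a b : nat) (s : 'S_a) (t : 'S_b),
    (0 < a)%N -> (0 < b)%N -> u <> fp (concat s t).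

Definition split_decomposition (u : fperm) (l : seq fperm) : Prop :=
  (forall p : fperm, p \in l -> connected p) /\ concat_seq l = u.

Definition has_split_type (u sigma : fperm) : Prop :=
  exists2 l : seq fperm, split_decomposition u l &
    sigma = concat_seq [seq p <- l | p != trivial_part].

(* sigma is a split type with q(sigma) = q; here m(sigma) is tag sigma. *)
Definition split_type_with (q : nat) (sigma : fperm) : Prop :=
  exists l : seq fperm,
    [/\ split_decomposition sigma l, trivial_part \notin l & size l = q].

(* Every u in S_oo lies in some S_n; the split type does not depend on n. *)
Definition sinf_has_split_type (u : Sinf) (sigma : fperm) : Prop :=
  exists n : nat, exists2 s : 'S_n, embed s = u & has_split_type (fp s) sigma.

Definition is_metric (T : Type) (K : realType) (D : T -> T -> K) : Prop :=
  [/\ forall x y : T, 0 <= D x y,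
      forall x y : T, D x y = 0 <-> x = y,
      forall x y : T, D x y = D y x &
      forall x y z : T, D x z <= D x y + D y z].

Definition right_invariant (K : realType) (D : Sinf -> Sinf -> K) : Prop :=
  forall u v w : Sinf, D (u * w)%g (v * w)%g = D u v.

Definition dist1 (K : realType) (D : Sinf -> Sinf -> K) (u : Sinf) : K :=
  D 1%g u.

Definition split_type_distance (K : realType) (D : Sinf -> Sinf -> K) : Prop :=
  forall (u v : Sinf) (sigma : fperm),
    sinf_has_split_type u sigma -> sinf_has_split_type v sigma ->
    dist1 D u = dist1 D v.

Definition A_count (K : realType) (D : Sinf -> Sinf -> K) (n : nat) (R : K) :
    nat :=
  #|[set s : 'S_n | dist1 D (embed s) == R]|.

Definition beta (K : realType) (D : Sinf -> Sinf -> K) (R : K) (m q : nat) :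
    nat :=
  #|[set s : 'S_m | `[< split_type_with q (fp s) >] &&
                    (dist1 D (embed s) == R)]|.

Definition bracket (i : int) (j : nat) : nat :=
  if j%:Z <= i then 'C(`|i|, j) else 0%N.

(* The binomial coefficient as a polynomial in its upper argument, which is
   what makes the second sum a polynomial in n. It differs from bracket on
   negative integers.                                                        *)
Definition gbinom (x : rat) (j : nat) : rat :=
  (\prod_(i < j) (x - i%:R)) / j`!%:R.

(* Num.truncn turns an integer upper bound into a natural one; it is 0 on
   negative integers, so that the outer sums are empty when N < 0.           *)
Definition bracket_sum (K : realType) (D : Sinf -> Sinf -> K) (R : K)
    (N : int) (n : nat) : nat :=
  (\sum_(1 <= q < (Num.truncn N).+1)
    \sum_(2 * q <= m < (Num.truncn (q%:Z + N)).+1)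
      beta D R m q * bracket (n%:Z + q%:Z - m%:Z) q)%N.

Definition binomial_sum (K : realType) (D : Sinf -> Sinf -> K) (R : K)
    (N : int) (n : nat) : rat :=
  \sum_(1 <= q < (Num.truncn N).+1)
    \sum_((2 * q)%N <= m < (Num.truncn (q%:Z + N)).+1)
      (beta D R m q)%:R * gbinom (n%:R + q%:R - m%:R) q.

(* Main.v *)
(** The split decomposition is unique: comparing two decompositions of the same
    permutation, a longer first part would itself split after the shorter one.
    So a permutation of [n] amounts to its split type [sigma], with
    [m = m(sigma)] and [q = q(sigma)], together with the positions of the [q]
    nontrivial parts among the [n - m + q] parts. Each split type is thus the
    type of [bracket (n + q - m) q] permutations of [n], all at the distance of
    [sigma] itself. At distance [R > 0] we have [q > 0], and [2 q <= m] because
    nontrivial connected permutations move at least two entries; with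
    [m - q <= N] this gives the ranges of the sums. *)

Require Import Defs.
From mathcomp Require Import all_boot all_order all_algebra all_fingroup.
From mathcomp Require Import boolp reals.
From mathcomp Require Import zify.
Set Implicit Arguments.
Unset Strict Implicit.
Unset Printing Implicit Defensive.
Import Order.TTheory GRing.Theory Num.Theory.
Local Open Scope ring_scope.

(** * Permutations as functions on [nat], and the concatenation monoid *)

Lemma embed_fun_ord (n : nat) (s : 'S_n) (i : 'I_n) : embed_fun s i = s i.
Proof. by rewrite /embed_fun valK. Qed.

Lemma embed_fun_ge (n : nat) (s : 'S_n) (k : nat) :
  (n <= k)%N -> embed_fun s k = k.
Proof. by move=> nk; rewrite /embed_fun insubN // -leqNgt. Qed.

Lemma embed_fun_lt (n : nat) (s : 'S_n) (k : nat) :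
  (embed_fun s k < n)%N = (k < n)%N.
Proof.
have [kn|nk] := ltnP k n; last by rewrite embed_fun_ge // ltnNge nk.
by rewrite (embed_fun_ord s (Ordinal kn)) ltn_ord.
Qed.

(** Comparing functions on [nat] avoids transporting permutations along equalities of sizes, such as
    associativity of addition. *)
Lemma fpermP (u v : fperm) : tag u = tag v ->
  embed_fun (tagged u) =1 embed_fun (tagged v) -> u = v.
Proof.
case: u v => n s [m t] /= nm; case: _ / nm t => t st.
by congr existT; apply/permP => i; apply/val_inj; rewrite /= -!embed_fun_ord st.
Qed.

Lemma embed_fun_concat (a b : nat) (s : 'S_a) (t : 'S_b) (k : nat) :
  embed_fun (concat s t) k =
  if (k < a)%N then embed_fun s k else (a + embed_fun t (k - a))%N.
Proof.
have [kab|abk] := ltnP k (a + b); last first.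
  rewrite ltnNge (leq_trans (leq_addr _ _) abk) /= !embed_fun_ge //; lia.
rewrite (embed_fun_ord (concat s t) (Ordinal kab)) permE /concat_fun.
case: splitP => i /= ->; rewrite ?ltn_ord ?embed_fun_ord //.
by rewrite ltnNge leq_addr addKn embed_fun_ord.
Qed.

Lemma perm_of_nat_fun (n : nat) (f : nat -> nat) :
  injective f -> (forall k : nat, (k < n)%N -> (f k < n)%N) ->
  exists s : 'S_n, forall k : nat, (k < n)%N -> embed_fun s k = f k.
Proof.
move=> f_inj fn; have inj : injective (fun i : 'I_n => Ordinal (fn i (ltn_ord i))).
  by move=> i j /(congr1 val)/f_inj/val_inj.
by exists (perm inj) => k kn; rewrite (embed_fun_ord _ (Ordinal kn)) permE.
Qed.

Lemma fconcatA (u v w : fperm) :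
  fconcat u (fconcat v w) = fconcat (fconcat u v) w.
Proof.
apply: fpermP => [|k] /=; first by rewrite addnA.
rewrite !embed_fun_concat subnDA.
have [ku|uk] := ltnP k (tag u); first by rewrite ltn_addr.
by rewrite -ltn_subLR //; case: ifP => _; rewrite ?addnA.
Qed.

Lemma fconcat0u (u : fperm) : fconcat (fp (1%g : 'S_0)) u = u.
Proof. by apply: fpermP => [|k] //=; rewrite embed_fun_concat subn0. Qed.

Lemma fconcatu0 (u : fperm) : fconcat u (fp (1%g : 'S_0)) = u.
Proof.
apply: fpermP => [|k] /=; first by rewrite addn0.
rewrite embed_fun_concat; case: ltnP => // uk.
by rewrite !embed_fun_ge // subnKC.
Qed.

(** * Existence and uniqueness of the split decomposition *)

Lemma fconcat_inj (u u' v v' : fperm) :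
  tag u = tag u' -> fconcat u v = fconcat u' v' -> u = u' /\ v = v'.
Proof.
move=> uu' uvE; have tagE : (tag u + tag v = tag u' + tag v')%N.
  by move: (congr1 tag uvE).
have funE k : (if (k < tag u)%N then embed_fun (tagged u) k
                else tag u + embed_fun (tagged v) (k - tag u))%N =
              (if (k < tag u)%N then embed_fun (tagged u') k
                else tag u + embed_fun (tagged v') (k - tag u))%N.
  rewrite [in RHS]uu' -!embed_fun_concat.
  by move: (congr1 (fun w : fperm => embed_fun (tagged w) k) uvE).
split; apply: fpermP => [|k] //.
- have := funE k; case: ltnP => // uk _.
  by rewrite !embed_fun_ge // -uu'.
- by move: tagE; rewrite uu' => /addnI.
by have := funE (tag u + k)%N; rewrite ltnNge leq_addr addKn => /addnI.
Qed.

(* If [|u| < |u'|], then [u'] maps [{0, ..., |u| - 1}] to itself, so it splits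
   after position [|u|].                                                     *)
Lemma connected_prefix_size (u u' v v' : fperm) :
  (0 < tag u)%N -> connected u' -> fconcat u v = fconcat u' v' ->
  (tag u' <= tag u)%N.
Proof.
move=> u_gt0 [_ u'_conn] uvE; rewrite leqNgt; apply/negP => uu'.
have funE k : embed_fun (concat (tagged u) (tagged v)) k =
              embed_fun (concat (tagged u') (tagged v')) k.
  by move: (congr1 (fun w : fperm => embed_fun (tagged w) k) uvE).
have vE k : (k < tag u' - tag u)%N ->
    (tag u + embed_fun (tagged v) k = embed_fun (tagged u') (tag u + k))%N.
  move=> kb; have := funE (tag u + k)%N; rewrite !embed_fun_concat.
  by rewrite ltnNge leq_addr addKn /= -ltn_subRL kb.
(* Past position [tag u], the entries of [u'] are those of [v] shifted. As [u'] preserves its own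
   range, [v] preserves its first [tag u' - tag u] entries; [t] is its restriction to them, and [u']
   is [u] followed by [t]. *)
have [k kb|t tE] :=
    @perm_of_nat_fun (tag u' - tag u) _ (bij_inj (embed_fun_bij (tagged v))).
  have : (embed_fun (tagged u') (tag u + k) < tag u')%N.
    by rewrite embed_fun_lt; lia.
  by rewrite -vE //; lia.
apply: (u'_conn _ _ (tagged u) t u_gt0); first by rewrite subn_gt0.
apply: fpermP => [|k] /=; first by rewrite subnKC // ltnW.
rewrite embed_fun_concat; case: ltnP => uk.
  by have := funE k; rewrite !embed_fun_concat uk (ltn_trans uk uu').
have [ku'|u'k] := ltnP k (tag u'); last first.
  by rewrite !embed_fun_ge ?leq_sub2r // subnKC.
by rewrite tE ?vE ?subnKC // ltn_sub2r.
Qed.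

Lemma concat_seq_cat (l l' : seq fperm) :
  concat_seq (l ++ l') = fconcat (concat_seq l) (concat_seq l').
Proof.
by elim: l => [|p l IHl] /=; rewrite ?fconcat0u // IHl fconcatA.
Qed.

(** Strong induction on the size: a nonempty permutation that is not connected is a concatenation of
    two shorter ones, whose decompositions are appended. *)
Lemma split_decomposition_exists (u : fperm) :
  exists l : seq fperm, split_decomposition u l.
Proof.
have [n] := ubnP (tag u); elim: n => // n IHn in u *; rewrite ltnS => un.
have [u0|u_gt0] := posnP (tag u).
  exists [::]; split=> //=; apply: fpermP => //= k.
  by rewrite !embed_fun_ge // u0.
have [u_conn|u_nconn] := pselect (connected u).
  exists [:: u]; split; last exact: fconcatu0.
  by move=> p; rewrite inE => /eqP->.
have [a [b [s [t [a_gt0 b_gt0 uE]]]]] : exists a b (s : 'S_a) (t : 'S_b),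
    [/\ (0 < a)%N, (0 < b)%N & u = fp (concat s t)].
  apply: contrapT => u_nsplit; apply: u_nconn; split=> // a b s t a0 b0 uE.
  by apply: u_nsplit; exists a, b, s, t.
have abn : (a + b <= n)%N by rewrite uE in un.
have [|l [l_conn lE]] := IHn (fp s); first by rewrite /=; lia.
have [|l' [l'_conn l'E]] := IHn (fp t); first by rewrite /=; lia.
exists (l ++ l'); split=> [p|]; last by rewrite concat_seq_cat lE l'E uE.
by rewrite mem_cat => /orP[/l_conn|/l'_conn].
Qed.

(** Applying [connected_prefix_size] in both directions gives the first parts equal sizes, so they
    can be cancelled and the tails compared by induction. *)
Lemma split_decomposition_unique (u : fperm) (l l' : seq fperm) :
  split_decomposition u l -> split_decomposition u l' -> l = l'.
Proof.
elim: l l' u => [|p l IHl] [|p' l'] u [l_conn lE] [l'_conn l'E] //.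
- have [p'_gt0 _] := l'_conn p' (mem_head _ _).
  have /= /eqP := congr1 tag l'E.
  by rewrite -lE /= addn_eq0 eqn0Ngt p'_gt0.
- have [p_gt0 _] := l_conn p (mem_head _ _).
  have /= /eqP := congr1 tag lE.
  by rewrite -l'E /= addn_eq0 eqn0Ngt p_gt0.
have p_conn := l_conn p (mem_head _ _).
have p'_conn := l'_conn p' (mem_head _ _).
have E : fconcat p (concat_seq l) = fconcat p' (concat_seq l').
  by rewrite -[LHS]/(concat_seq (p :: l)) lE -l'E.
have pp' : tag p = tag p'.
  apply/anti_leq; rewrite (connected_prefix_size p'_conn.1 p_conn (esym E)).
  exact: connected_prefix_size p_conn.1 p'_conn E.
have [-> ll'] := fconcat_inj pp' E; congr cons.
apply: (IHl l' (concat_seq l)); split=> // q ql.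
  by apply: l_conn; rewrite inE ql orbT.
by apply: l'_conn; rewrite inE ql orbT.
Qed.

(** * Removing and reinserting trivial parts *)

Lemma tag_concat_seq (l : seq fperm) :
  tag (concat_seq l) =
  (tag (concat_seq [seq p <- l | p != trivial_part])
   + count_mem trivial_part l)%N.
Proof.
elim: l => [|p l IHl] //=; rewrite IHl.
by case: eqVneq => [->|_] /=; lia.
Qed.

Lemma connected_nontrivial (p : fperm) :
  connected p -> p != trivial_part -> (1 < tag p)%N.
Proof.
case: p => n s [/= n_gt0 _] s_ntriv; rewrite ltn_neqAle n_gt0 andbT.
apply: contra s_ntriv => /eqP n1; case: _ / n1 s => s.
by apply/eqP; congr fp; apply/permP => i; rewrite !ord1.
Qed.

(** Inverse to separating a list into its entries other than [x] and the mask of their positions.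
    The last branch truncates when the mask and the list do not match, hence the condition
    [count id b = size l] in the lemmas below that recover the mask and the list. *)
Fixpoint weave (T : Type) (x : T) (b : seq bool) (l : seq T) : seq T :=
  match b, l with
  | true :: b', y :: l' => y :: weave x b' l'
  | false :: b', _ => x :: weave x b' l
  | _, _ => [::]
  end.

Section Weave.
Variables (T : eqType) (x : T).
Implicit Types (b : seq bool) (l : seq T).

Lemma weaveK l : weave x [seq y != x | y <- l] [seq y <- l | y != x] = l.
Proof. by elim: l => //= y l IHl; case: eqVneq => [->|] /=; rewrite IHl. Qed.

Lemma map_weave b l :
  x \notin l -> count id b = size l -> [seq y != x | y <- weave x b l] = b.
Proof.
elim: b l => [|[] b IHb] //= [|y l] //= xl bl; rewrite ?eqxx ?IHb //.
  by move: xl; rewrite inE negb_or eq_sym => /andP[->].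
  by move: xl; rewrite inE negb_or => /andP[].
by case: bl.
Qed.

Lemma filter_weave b l :
  x \notin l -> count id b = size l -> [seq y <- weave x b l | y != x] = l.
Proof.
elim: b l => [|[] b IHb] //= [|y l] //=; rewrite ?eqxx /= => xl.
- rewrite add1n => -[bl]; move: xl; rewrite inE negb_or eq_sym => /andP[-> xl].
  by rewrite IHb.
- by move=> bl; rewrite IHb.
- by move=> bl; rewrite IHb.
Qed.

Lemma mem_weave b l : {subset weave x b l <= x :: l}.
Proof.
elim: b l => [|[] b IHb] // [|y l] z //=.
- by rewrite !inE => /orP[->|/IHb]; rewrite ?orbT // inE => /orP[]->; rewrite ?orbT.
- by rewrite inE => /orP[/eqP->|/IHb//]; rewrite inE eqxx.
- by rewrite inE => /orP[/eqP->|/IHb//]; rewrite inE eqxx.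
Qed.

End Weave.

(** * The split type as a function *)

Definition split_parts (u : fperm) : seq fperm :=
  sval (cid (split_decomposition_exists u)).

Definition nontrivial_parts (u : fperm) : seq fperm :=
  [seq p <- split_parts u | p != trivial_part].

Definition split_type (u : fperm) : fperm := concat_seq (nontrivial_parts u).

Lemma split_partsP (u : fperm) : split_decomposition u (split_parts u).
Proof. exact: svalP (cid (split_decomposition_exists u)). Qed.

Lemma split_parts_eq (u : fperm) (l : seq fperm) :
  split_decomposition u l -> split_parts u = l.
Proof. exact: split_decomposition_unique (split_partsP u). Qed.

Lemma has_split_type_split_type (u : fperm) : has_split_type u (split_type u).
Proof. by exists (split_parts u) => //; apply: split_partsP. Qed.

Lemma split_type_decomposition (u : fperm) :
  split_decomposition (split_type u) (nontrivial_parts u).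
Proof.
split=> // p; rewrite mem_filter => /andP[_].
by have [+ _] := split_partsP u; apply.
Qed.

Lemma split_type_with_split_type (u : fperm) :
  split_type_with (size (nontrivial_parts u)) (split_type u).
Proof.
exists (nontrivial_parts u); split=> //; first exact: split_type_decomposition.
by rewrite mem_filter eqxx.
Qed.

Lemma split_type_with_unique (u : fperm) (q q' : nat) :
  split_type_with q u -> split_type_with q' u -> q = q'.
Proof.
move=> [l [ul _ <-]] [l' [ul' _ <-]].
by rewrite (split_decomposition_unique ul ul').
Qed.

Lemma has_split_type_self (u : fperm) (q : nat) :
  split_type_with q u -> has_split_type u u.
Proof.
move=> [l [ul ltriv _]]; exists l => //; case: ul => _ <-.
congr concat_seq; apply/esym/all_filterP/allP => p pl.
by apply: contraNneq ltriv => <-.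
Qed.

Lemma size_nontrivial_parts (u : fperm) :
  (2 * size (nontrivial_parts u) <= tag (split_type u))%N.
Proof.
have [+ _] := split_type_decomposition u.
have : all (fun p => p != trivial_part) (nontrivial_parts u) by apply: filter_all.
rewrite /split_type; elim: nontrivial_parts => //= p l IHl.
move=> /andP[p_ntriv l_ntriv] pl_conn.
have p_gt1 : (1 < tag p)%N.
  by apply: connected_nontrivial p_ntriv; apply: pl_conn; rewrite mem_head.
by rewrite mulnS leq_add // IHl // => r rl; apply: pl_conn; rewrite inE rl orbT.
Qed.

Lemma tag_split_type (u : fperm) :
  tag u = (tag (split_type u) + count_mem trivial_part (split_parts u))%N.
Proof. by have [_ {1}<-] := split_partsP u; rewrite tag_concat_seq. Qed.

Lemma connected_trivial_part : connected trivial_part.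
Proof.
split=> // a b s t a_gt0 b_gt0 /(congr1 tag) /= ab.
by have := leq_add a_gt0 b_gt0; rewrite -ab.
Qed.

(** * Counting the permutations with a given split type *)

Lemma bracket_nat (i j : nat) : bracket i j = 'C(i, j).
Proof. by rewrite /bracket lez_nat absz_nat; case: leqP => // /bin_small. Qed.

(* A permutation in S_n with a given split type, with parts [l], is determined
   by the positions of the [q] parts [l] among the [n - m + q] parts.        *)
Lemma card_split_type (n m q : nat) (sigma : 'S_m) :
  split_type_with q (fp sigma) ->
  #|[set s : 'S_n | split_type (fp s) == fp sigma]| =
  bracket (n%:Z + q%:Z - m%:Z) q.
Proof.
move=> [l [[l_conn lE] trivl lq]].
have partsE u : split_type u = fp sigma -> nontrivial_parts u = l.
  move=> uE; apply: split_decomposition_unique (split_type_decomposition u) _.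
  by rewrite uE.
(* If [n < m], both sides vanish: a split type is no longer than its permutation, and
   [n + q - m < q]. *)
have [nm|mn] := ltnP n m.
  rewrite /bracket ifN; last lia.
  apply: eq_card0 => s; rewrite inE; apply: contraTF nm => /eqP sE.
  by have /= -> := tag_split_type (fp s); rewrite sE -leqNgt leq_addr.
rewrite (_ : _ + _ = (n - m + q)%:Z); last lia.
set k := (n - m + q)%N; rewrite bracket_nat -[k in 'C(k, q)]card_ord -card_draws.
(* A set [A] of [q] positions becomes a mask, and [w A] places the parts [l] at these positions and
   trivial parts elsewhere. *)
pose b (A : {set 'I_k}) := [seq i \in A | i <- enum 'I_k].
have size_b A : size (b A) = k by rewrite size_map size_enum_ord.
have count_b (A : {set 'I_k}) : #|A| = q -> count id (b A) = size l.
  by rewrite lq count_map => <-; rewrite cardE -size_filter enumT.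
pose w A := weave trivial_part (b A) l.
have wP A : split_decomposition (concat_seq (w A)) (w A).
  split=> // p /mem_weave; rewrite inE => /orP[/eqP->|/l_conn//].
  exact: connected_trivial_part.
have tag_w (A : {set 'I_k}) : #|A| = q -> tag (concat_seq (w A)) = n.
  move=> Aq; rewrite tag_concat_seq filter_weave ?count_b // lE /=.
  have /(congr1 size) := map_weave trivl (count_b A Aq).
  rewrite size_map size_b => wk.
  have wq : count (predC (pred1 trivial_part)) (w A) = q.
    by rewrite -lq -[in RHS](filter_weave trivl (count_b A Aq)) size_filter.
  have /eqP := count_predC (pred1 trivial_part) (w A).
  by rewrite wk wq /k eqn_add2r => /eqP->; rewrite subnKC.
(* [h A] is the permutation with parts [w A], seen in ['S_n]; by [tag_w] the default is never taken
   when [A] has [q] elements. *)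
pose h A : 'S_n := odflt 1%g [pick s : 'S_n | fp s == concat_seq (w A)].
have hP (A : {set 'I_k}) : #|A| = q -> fp (h A) = concat_seq (w A).
  move=> /tag_w; rewrite /h; case: pickP => [s /eqP->//|/= noS].
  case: (concat_seq (w A)) noS => n' t /= + n'n; case: _ / n'n.
  by move=> /(_ t); rewrite eqxx.
(* Injectivity of [h]: uniqueness of the decomposition recovers [w A], whose nontrivial positions
   are [A]. *)
rewrite -(@card_in_imset _ _ h); last first.
  move=> A B; rewrite !inE => /eqP Aq /eqP Bq /(congr1 (@fp n)).
  rewrite !hP // => wAB.
  have {wAB} : w A = w B.
    by rewrite -(split_parts_eq (wP A)) -(split_parts_eq (wP B)) wAB.
  move=> /(congr1 (map (fun p => p != trivial_part))).
  rewrite !map_weave ?count_b // => /eq_in_map AB.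
  by apply/setP => i; apply: AB; rewrite mem_enum.
apply: eq_card => s; rewrite inE; apply/eqP/imsetP => [sE|[A]]; last first.
  rewrite inE => /eqP Aq ->; rewrite hP // -lE /split_type /nontrivial_parts.
  by rewrite (split_parts_eq (wP A)) filter_weave ?count_b.
(* Surjectivity: [s] is the image of the set of positions of its nontrivial parts, encoded by the
   mask [c]. *)
have wE := weaveK trivial_part (split_parts (fp s)).
rewrite -[filter _ _]/(nontrivial_parts (fp s)) partsE // in wE.
set c := map _ _ in wE.
have size_c : size c = k.
  rewrite size_map -(count_predC (pred1 trivial_part)) /k -lq -(partsE _ sE).
  rewrite size_filter; congr addn.
  have : n = (m + count_mem trivial_part (split_parts (fp s)))%N.
    by have := tag_split_type (fp s); rewrite sE.
  by move/(congr1 (subn^~ m)); rewrite addKn.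
pose A := [set i : 'I_k | nth false c i].
have bA : b A = c.
  have -> : b A = map (nth false c \o val) (enum 'I_k).
    by apply: eq_map => i; rewrite inE.
  by rewrite map_comp val_enum_ord -size_c map_nth_iota0 ?take_size.
have Aq : #|A| = q.
  have -> : #|A| = count id (b A) by rewrite count_map cardE -size_filter enumT.
  by rewrite bA -lq -(partsE _ sE) count_map size_filter.
exists A; first by rewrite inE Aq.
have : fp s = fp (h A).
  by rewrite hP // /w bA wE; have [_ ->] := split_partsP (fp s).
by move/eqP; rewrite -tag_eqE /tag_eq /= eqxx tagged_asE => /eqP.
Qed.

(** * Binomial polynomials and the bounds of the sums *)

Lemma gbinom_nat (i j : nat) : gbinom i%:R j = 'C(i, j)%:R.
Proof.
rewrite /gbinom; have [ij|ji] := ltnP i j.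
  rewrite bin_small // (bigD1 (Ordinal ij)) //= subrr !mul0r //.
have j_neq0 : j`!%:R != 0 :> rat by rewrite pnatr_eq0 -lt0n fact_gt0.
apply: (canLR (mulfK j_neq0)); rewrite -natrM bin_ffact ffact_prod natr_prod.
apply: eq_bigr => k _; rewrite natrB //; have := ltn_ord k; lia.
Qed.

Lemma dist1_refl (K : realType) (D : Sinf -> Sinf -> K) :
  is_metric D -> dist1 D (embed (1%g : 'S_0)) = 0.
Proof.
move=> [_ D0 _ _]; apply/D0/esym/sinfP => k /=; exact: embed_fun_ge.
Qed.

(** Since [q] is positive, the value 0 of [Num.truncn] on negative integers does no harm. *)
Lemma ltnS_truncn (q : nat) (N : int) :
  (0 < q)%N -> (q < (Num.truncn N).+1)%N = (q%:Z <= N).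
Proof. by case: q => // q _; rewrite ltnS truncn_gt_nat natz. Qed.

(** The binomial coefficient of ['X + c] over [j], written with monic linear factors. *)
Definition gbinom_poly (c : rat) (j : nat) : {poly rat} :=
  (j`!%:R)^-1 *: \prod_(i < j) ('X - (i%:R - c)%:P).

Lemma horner_gbinom_poly (c x : rat) (j : nat) :
  (gbinom_poly c j).[x] = gbinom (x + c) j.
Proof.
rewrite hornerZ horner_prod /gbinom mulrC; congr (_ / _).
by apply: eq_bigr => i _; rewrite hornerXsubC opprB addrA.
Qed.

Lemma size_gbinom_poly (c : rat) (j : nat) : (size (gbinom_poly c j) <= j.+1)%N.
Proof.
apply: leq_trans (size_scale_leq _ _) _.
by rewrite -big_enum size_prod_XsubC size_enum_ord.
Qed.

(** * Counting the permutations at distance [R] *)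

Lemma dist1_split_type (K : realType) (D : Sinf -> Sinf -> K)
  (m n : nat) (sigma : 'S_m) (s : 'S_n) :
  split_type_distance D -> split_type (fp s) = fp sigma ->
  dist1 D (embed s) = dist1 D (embed sigma).
Proof.
move=> D_split_type sE; apply: (D_split_type _ _ (fp sigma)).
  by exists n, s => //; rewrite -sE; apply: has_split_type_split_type.
exists m, sigma => //; apply: has_split_type_self.
by rewrite -sE; apply: split_type_with_split_type.
Qed.

(** Without nontrivial parts the split type is the empty permutation, which embeds as the identity,
    at distance 0. *)
Lemma size_nontrivial_parts_gt0 (K : realType) (D : Sinf -> Sinf -> K)
  (n : nat) (s : 'S_n) :
  is_metric D -> split_type_distance D -> 0 < dist1 D (embed s) ->
  (0 < size (nontrivial_parts (fp s)))%N.
Proof.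
move=> D_metric D_split_type; rewrite lt0n; apply: contraTN => /nilP s_triv.
rewrite (@dist1_split_type _ _ 0 _ 1%g) ?dist1_refl ?ltxx //.
by rewrite /split_type s_triv.
Qed.

(** Double counting of pairs of a permutation in [S] and its split type: each [s] in [S] contributes
    exactly once to the double sum. *)
Lemma A_count_bracket_sum (K : realType) (D : Sinf -> Sinf -> K) (R : K)
  (N : int) (n : nat) :
  is_metric D -> split_type_distance D -> 0 < R ->
  (forall (m q : nat) (sigma : 'S_m),
     split_type_with q (fp sigma) -> dist1 D (embed sigma) = R ->
     m%:Z - q%:Z <= N) ->
  A_count D n R = bracket_sum D R N n.
Proof.
move=> D_metric D_split_type R_gt0 N_bound.
pose B m q := [set s : 'S_m | `[< split_type_with q (fp s) >] &&
                              (dist1 D (embed s) == R)].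
pose S := [set s : 'S_n | dist1 D (embed s) == R].
(* Restricting [s] to [S] loses nothing, as [s] lies at the same distance as its split type. *)
have betaE m q : (beta D R m q * bracket (n%:Z + q%:Z - m%:Z) q =
    \sum_(s in S) \sum_(sigma in B m q) (split_type (fp s) == fp sigma))%N.
  rewrite exchange_big /= -sum_nat_const; apply: eq_bigr => sigma.
  rewrite inE => /andP[/asboolP sigma_q /eqP sigma_R].
  rewrite -(card_split_type n sigma_q) -big_mkcondr sum1_card /=.
  apply: eq_card => s; rewrite !inE unfold_in /= inE.
  case: eqP => [sE|]; rewrite ?andbF // andbT; apply/esym/eqP.
  by rewrite (dist1_split_type D_split_type sE).
rewrite /bracket_sum; under eq_bigr => q _ do
  (under eq_bigr => m _ do rewrite betaE; rewrite exchange_big /=).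
rewrite exchange_big /= /A_count -/S -sum1_card.
apply: eq_bigr => s; rewrite inE => /eqP sR; apply/esym.
have := size_nontrivial_parts_gt0 D_metric D_split_type; rewrite -sR in R_gt0.
move=> /(_ _ _ R_gt0).
have := split_type_with_split_type (fp s); have := size_nontrivial_parts (fp s).
case sE : (split_type (fp s)) => [m0 sigma0] /=.
move: (size _) => q0 q0_le sigma0_q0 q0_gt0.
have sigma0_R : dist1 D (embed sigma0) = R.
  by rewrite -(dist1_split_type D_split_type sE).
have mqN := N_bound _ _ _ sigma0_q0 sigma0_R.
(* For fixed [s], only the size [m0] and the number of parts [q0] of its split type [sigma0]
   contribute. *)
have sumB m q :
    (\sum_(sigma in B m q) (existT _ m0 sigma0 == fp sigma :> fperm) =
     if m == m0 then if q == q0 then 1 else 0 else 0)%N.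
  have [mm0|mm0] := eqVneq m m0; last first.
    by apply: big1 => sigma _; rewrite -tag_eqE /tag_eq /= eq_sym (negPf mm0).
  subst m; have [->|qq0] := eqVneq q q0; last first.
    apply: big1 => sigma; rewrite inE => /andP[/asboolP sigma_q _].
    case: eqP => // sigmaE; case/eqP: qq0.
    by apply: split_type_with_unique sigma_q _; rewrite -sigmaE.
  have sigma0B : sigma0 \in B m0 q0 by rewrite inE asboolT //= sigma0_R.
  rewrite (bigD1 sigma0) //= eqxx big1 // => sigma /andP[_ sigma_neq].
  apply/eqP; rewrite eqb0; apply: contra sigma_neq.
  by rewrite -tag_eqE /tag_eq /= eqxx tagged_asE eq_sym.
under eq_bigr => q _ do
  (under eq_bigr => m _ do rewrite sumB; rewrite -big_mkcond big_nat1_eq).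
have m0_gt0 : (0 < m0)%N by apply: leq_trans q0_le; rewrite muln_gt0.
(* The size [m0] is in range for [q0] because [2 * q0 <= m0] and [m0 - q0 <= N]; together these also
   give [q0 <= N]. *)
transitivity (\sum_(1 <= q < (Num.truncn N).+1 | q == q0) 1)%N.
  rewrite [RHS]big_mkcond; apply: eq_bigr => q _.
  case: eqVneq => [->|]; last by case: ifP.
  by rewrite q0_le ltnS_truncn // -lerBlDl mqN.
rewrite big_nat1_eq q0_gt0 ltnS_truncn // ifT //; lia.
Qed.

(** * The polynomial form *)

(** In the range of summation [m <= q + N <= q + n], so the upper arguments are nonnegative, where
    [bracket] and [gbinom] agree. *)
Lemma bracket_sum_binomial_sum (K : realType) (D : Sinf -> Sinf -> K) (R : K)
  (N : int) (n : nat) :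
  N <= n%:Z -> (bracket_sum D R N n)%:R = binomial_sum D R N n.
Proof.
move=> Nn; rewrite /bracket_sum natr_sum; apply: eq_big_nat => q /andP[q_gt0 qN].
rewrite natr_sum; apply: eq_big_nat => m /andP[qm mqN].
have m_gt0 : (0 < m)%N by apply: leq_trans qm; rewrite muln_gt0.
rewrite ltnS_truncn // in mqN.
have mnq : (m <= n + q)%N by lia.
rewrite (_ : _ - m%:Z = (n + q - m)%:Z); last lia.
by rewrite bracket_nat natrM -natrD -natrB // gbinom_nat.
Qed.

Definition binomial_sum_poly (K : realType) (D : Sinf -> Sinf -> K) (R : K)
    (N : int) : {poly rat} :=
  \sum_(1 <= q < (Num.truncn N).+1)
    \sum_((2 * q)%N <= m < (Num.truncn (q%:Z + N)).+1)
      (beta D R m q)%:R *: gbinom_poly (q%:R - m%:R) q.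

Lemma horner_binomial_sum_poly (K : realType) (D : Sinf -> Sinf -> K) (R : K)
  (N : int) (n : nat) :
  (binomial_sum_poly D R N).[n%:R] = binomial_sum D R N n.
Proof.
rewrite horner_sum; apply: eq_bigr => q _; rewrite horner_sum.
by apply: eq_bigr => m _; rewrite hornerZ horner_gbinom_poly addrA.
Qed.

(** Each summand has degree at most [q], and [q] is at most [Num.truncn N]. *)
Lemma size_binomial_sum_poly (K : realType) (D : Sinf -> Sinf -> K) (R : K)
  (N : int) :
  (size (binomial_sum_poly D R N) <= (Num.truncn N).+1)%N.
Proof.
have sizeD (p r : {poly rat}) (d : nat) :
    (size p <= d)%N -> (size r <= d)%N -> (size (p + r)%R <= d)%N.
  by move=> pd rd; apply: leq_trans (size_polyD _ _) _; rewrite geq_max pd.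
rewrite /binomial_sum_poly big_nat_cond.
apply: (big_ind (fun p : {poly rat} => (size p <= (Num.truncn N).+1)%N)).
- by rewrite size_poly0.
- by move=> p r; apply: sizeD.
move=> q /andP[/andP[_ qN] _].
apply: (big_ind (fun p : {poly rat} => (size p <= (Num.truncn N).+1)%N)).
- by rewrite size_poly0.
- by move=> p r; apply: sizeD.
move=> m _; apply: leq_trans (size_scale_leq _ _) _.
exact: leq_trans (size_gbinom_poly _ _) qN.
Qed.

Theorem theorem3p2 (K : realType) (D : Sinf -> Sinf -> K) (R : K) (N : int)
  (D_metric : is_metric D)
  (D_right_invariant : right_invariant D)
  (D_split_type : split_type_distance D)
  (R_gt0 : 0 < R)
  (N_bound : forall (m q : nat) (sigma : 'S_m),
     split_type_with q (fp sigma) -> dist1 D (embed sigma) = R ->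
     m%:Z - q%:Z <= N) :
  (forall n : nat, (1 <= n)%N -> A_count D n R = bracket_sum D R N n) /\
  (forall n : nat, (1 <= n)%N -> N <= n%:Z ->
     (A_count D n R)%:R = binomial_sum D R N n) /\
  (exists p : {poly rat},
     (p != 0 -> (size p).-1%:Z <= N) /\
     (forall n : nat, (1 <= n)%N -> N <= n%:Z ->
        binomial_sum D R N n = p.[n%:R])).
Proof.
have AE n := A_count_bracket_sum n D_metric D_split_type R_gt0 N_bound.
split=> [n _|]; first exact: AE.
split=> [n _ Nn|]; first by rewrite AE bracket_sum_binomial_sum.
exists (binomial_sum_poly D R N); split; last first.
  by move=> n _ _; rewrite horner_binomial_sum_poly.
have size_p := size_binomial_sum_poly D R N.
(* For negative [N] the outer sum is empty, so the polynomial is 0 and the degree bound is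
   vacuous. *)
have [N_ge0 _|N_lt0] := lerP 0 N.
  have := truncn_le N; rewrite N_ge0 natz; apply: le_trans.
  by rewrite lez_nat -subn1 leq_subLR.
rewrite /binomial_sum_poly (truncn0Pn _ _); last by rewrite -ltNge; lia.
by rewrite big_geq ?eqxx.
Qed.
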